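(* Let $n$ be an odd integer. If an edge-coloring of a complete graph contains no rainbow $n$-cycle, then it contains no rainbow $m$-cycle for every integer $m \ge 2n^2$.
   Context: A coloring is an arbitrary (not necessarily proper) assignment of colors, from an arbitrary set, to the edges of an undirected complete graph; the graph may be finite or infinite. A rainbow $n$-cycle in a coloring is a cycle through $n$ distinct vertices whose $n$ edges all receive pairwise distinct colors. *)

(* Defs.v *)
From mathcomp Require Import all_boot.
Set Implicit Arguments. Unset Strict Implicit. Unset Printing Implicit Defensive.

(* A coloring of the complete graph on vertex set V (possibly infinite) with
   colors in C is a symmetric map c : V -> V -> C; c x y is the color of the
   edge {x, y} (x <> y); values on the diagonal are irrelevant. *)
Definition coloring_sym (V C : Type) (c : V -> V -> C) : Prop :=
  forall x y : V, c x y = c y x.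

Definition rainbow_cycle (V C : Type) (c : V -> V -> C) (n : nat) : Prop :=
  3 <= n /\
  exists v : nat -> V,
    (forall i j, i < n -> j < n -> v i = v j -> i = j) /\
    (forall i j, i < n -> j < n ->
       c (v i) (v (i.+1 %% n)) = c (v j) (v (j.+1 %% n)) -> i = j).

(* Main.v *)
From Stdlib Require Import ZArith Lia Classical ClassicalEpsilon.
Require Import Defs.
From mathcomp Require Import all_boot zify.
Set Implicit Arguments. Unset Strict Implicit. Unset Printing Implicit Defensive.

(* Put d = n - 2 and index the vertices of a rainbow M-cycle by Z modulo M. As
   there is no rainbow n-cycle, a chord v_i v_{i+d+1} has the colour of an edge
   on its short side, so the long side closes up to a rainbow (M-d)-cycle.

   If M >= 12 d there is also a rainbow (M-2d+2)-cycle. The chords from i and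
   i + d overlap in the single edge i + d, and crossing them gives such a cycle
   unless one of them has the colour of that edge. If this fails for every i,
   each chord v_i v_{i+d+1} has the colour of its last edge or of its first
   edge, which of the two depends only on i modulo d, and the same holds for
   all chords of span 1 modulo d. If both kinds occur, an explicit rainbow
   n-cycle exists. If only one occurs, every edge has the colour attached to
   one of its endpoints; orienting edges towards that endpoint gives a
   tournament with a directed Hamiltonian cycle, hence by Moon's theorem a
   directed n-cycle, which is rainbow.

   Since d is odd, at most d - 1 moves M -> M - 2d + 2 reach a length that is 2
   modulo d, and moves M -> M - d then descend to n. *)

(** * Moon's theorem on directed cycles in tournaments *)

Section Moon.
Context (T : eqType) (e : rel T).

Lemma path_switch (P : pred T) x s : path e x s -> P x -> ~~ P (last x s) ->
  exists p1 u w p2, [/\ x :: s = p1 ++ u :: w :: p2, e u w, P u & ~~ P w].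
Proof.
elim: s x => [|y s IH] x /=; first by move=> _ ->.
case/andP=> exy pys Px Pl; have [Py|nPy] := boolP (P y).
  have [p1 [u [w [p2 [E euw Pu Pw]]]]] := IH y pys Py Pl.
  by exists (x :: p1), u, w, p2; rewrite E.
by exists [::], x, y, s.
Qed.

(** The cycle is rotated so that the arc from [u] to [w], where [P] stops holding, becomes the
    closing arc. A new vertex can then be inserted there by consing it in front. *)
Lemma cycle_switch (P : pred T) h x y : cycle e h ->
  x \in h -> y \in h -> P x -> ~~ P y ->
  exists u w p, [/\ perm_eq (w :: rcons p u) h, cycle e (w :: rcons p u),
                    P u & ~~ P w].
Proof.
move=> ch xh yh Px nPy.
have [i s E] := rot_to xh.
have cs : cycle e (x :: s) by rewrite -E rot_cycle.
have ys : y \in x :: s by rewrite -E mem_rot.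
have nxy : y != x by apply: contraNneq nPy => ->.
move: ys; rewrite inE (negbTE nxy) /= => ys.
case/splitPr: ys E cs => s1 s2 E cs.
have : path e x (rcons s1 y).
  move: cs; rewrite /= rcons_cat cat_path /= => /and3P[p1 e1 _].
  by rewrite rcons_path p1.
move/path_switch=> /(_ P Px); rewrite last_rcons => /(_ nPy).
move=> [q1 [u [w [q2 [Eq euw Pu Pw]]]]].
have E2 : x :: s1 ++ y :: s2 = rcons q1 u ++ (w :: q2 ++ s2).
  by rewrite -cat_rcons -cat_cons Eq cat_rcons -catA.
exists u, w, ((q2 ++ s2) ++ q1).
have E3 : w :: rcons ((q2 ++ s2) ++ q1) u = rot (size (rcons q1 u)) (x :: s1 ++ y :: s2).
  by rewrite E2 rot_size_cat cat_cons rcons_cat.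
have C3 : cycle e (w :: rcons ((q2 ++ s2) ++ q1) u) by rewrite E3 rot_cycle.
by split=> //; rewrite E3 perm_rot -E perm_rot.
Qed.

(* Moon's theorem: the cycle [h] grows out of a triangle one vertex at a time.
   A vertex of [h] off the current cycle [s] with both in- and out-neighbours
   on [s] can be inserted; if there is none, [h] runs from a vertex dominated
   by [s] to one dominating [s], and these two replace one vertex of [s]. *)
Lemma tournament_pancyclic (h : seq T) :
  (forall x y, x \in h -> y \in h -> x != y -> e x y = ~~ e y x) ->
  uniq h -> cycle e h ->
  forall k, 3 <= k <= size h ->
  exists s, [/\ size s = k, uniq s, cycle e s & {subset s <= h}].
Proof.
move=> tour uh ch; elim=> [|k IH] // /andP[]; rewrite leq_eqVlt => /orP[/eqP[<-] kh|hk kh].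
  case: h tour uh ch kh {IH} => [|x [|y s]] // tour uh ch _.
  have xs z : z \in y :: s -> x != z.
    by move=> zs; apply: contraTneq uh => ->; rewrite /= zs.
  have := ch; rewrite (cycle_path x) /= => /and3P[elx exy pys].
  have xh : x \in [:: x, y & s] by rewrite inE eqxx.
  have sh z : z \in y :: s -> z \in [:: x, y & s] by move=> zs; rewrite inE zs orbT.
  have ls : last y s \in y :: s by rewrite mem_last.
  have nl : ~~ e x (last y s).
    by rewrite -(tour (last y s) x (sh _ ls) xh) // eq_sym; exact: xs.
  (* Among the other vertices of the cycle, the first is an out-neighbour of [x] and the last is
     not. An arc where this changes forms a directed triangle with [x]. *)
  have [p1 [u [w [p2 [E euw exu nexw]]]]] := path_switch pys exy nl.
  have us : u \in y :: s by rewrite E mem_cat !inE eqxx orbT.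
  have ws : w \in y :: s by rewrite E mem_cat !inE eqxx !orbT.
  have nuw : u != w by apply: contraNneq nexw => <-.
  exists [:: x; u; w]; split=> //.
  - by rewrite /= !inE negb_or !xs // nuw.
  - by rewrite /= exu euw (tour w x (sh _ ws) xh) ?nexw // eq_sym; exact: xs.
  - by move=> z; rewrite in_cons in_cons inE => /or3P[] /eqP-> //; exact: sh.
have [|s [ss us cs sh]] := IH; first by rewrite -ltnS hk ltnW.
have [/existsP|] := boolP [exists i : 'I_(size h), let w := tnth (in_tuple h) i in
    [&& w \notin s, has (fun x => e x w) s & has (fun x => ~~ e x w) s]].
  move=> [i]; set w := tnth _ _ => /= /and3P[ws /hasP[x xs exw] /hasP[y ys eyw]].
  have wh : w \in h by exact: mem_tnth.
  have [u [z [p [pe cp euw nezw]]]] := @cycle_switch (fun x => e x w) s x y cs xs ys exw eyw.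
  have zs : z \in s by rewrite -(perm_mem pe) inE eqxx.
  exists [:: w, z & rcons p u]; split.
  - by rewrite /= -ss -(perm_size pe).
  - by rewrite cons_uniq (perm_mem pe) ws (perm_uniq pe).
  - move: cp; rewrite /= !rcons_path last_rcons => /andP[-> _]; rewrite euw andbT.
    rewrite (tour w z wh (sh _ zs)) ?nezw //.
    by apply: contraNneq ws => ->.
  - by move=> t; rewrite inE (perm_mem pe) => /orP[/eqP->|/sh].
rewrite negb_exists => /forallP noins.
have dich w : w \in h -> w \notin s -> all (fun x => e x w) s \/ all (fun x => ~~ e x w) s.
  move=> wh ws; have wi : index w h < size h by rewrite index_mem.
  have := noins (Ordinal wi); rewrite (tnth_nth w) /= nth_index // ws /=.
  rewrite negb_and => /orP[] H; [right|left]; first by rewrite all_predC.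
  by move: H; rewrite has_predC negbK.
have [o oh Oo] : exists2 o, o \in h & (o \notin s) && all (fun x => e x o) s.
  have [w wh ws] : exists2 w, w \in h & w \notin s.
    apply/hasP; rewrite -[has _ _]negbK has_predC negbK; apply/negP=> /allP H.
    by have := uniq_leq_size uh H; rewrite ss leqNgt kh.
  have [Ow|Iw] := dich w wh ws; first by exists w; rewrite // ws Ow.
  case: s ss us cs sh noins dich ws Iw hk => [<-|x0 s'] //;
    set s := x0 :: s' => ss us cs sh _ dich ws Iw _.
  (* Here [w] dominates [s]. Going round [h] from [x0] to [w], some arc from [a] to [b] enters the
     set of vertices that dominate [s]. Then [a] lies off [s], because [b] beats all of [s], so [a]
     is dominated by [s]. *)
  have [||||a [b [p [pe cp nIb Ib]]]]
    := @cycle_switch (fun x => ~~ ((x \notin s) && all (fun y => ~~ e y x) s)) h x0 w ch.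
  - by apply: sh; rewrite inE eqxx.
  - by [].
  - by rewrite inE eqxx.
  - by rewrite negbK ws.
  move: Ib; rewrite negbK => /andP[bs Ib].
  have ah : a \in h by rewrite -(perm_mem pe) inE mem_rcons inE eqxx orbT.
  have eab : e a b by move: cp; rewrite /= rcons_path last_rcons => /andP[].
  have [as_|as_] := boolP (a \in s); first by rewrite (negPf (allP Ib _ as_)) in eab.
  exists a => //; rewrite as_ /=; have [//|Ia] := dich a ah as_.
  by rewrite as_ Ia in nIb.
case/andP: Oo => os Oo.
case: s ss us cs sh noins dich os Oo hk => [<-|x [<-|y [<-|z s']]] //;
  set s := [:: x, y, z & s'] => ss us cs sh _ dich os Oo _.
(* This arc leaves the set of vertices dominated by [s]. Its head [b] is not on [s], since [s] beats
   [a], so [b] dominates [s]. Replacing [y] by [a, b] adds one vertex. *)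
have [|||a [b [p [pe cp Oa nOb]]]]
  := @cycle_switch (fun t => (t \notin s) && all (fun y => e y t) s) h o x ch oh.
- by apply: sh; rewrite inE eqxx.
- by rewrite os.
- by rewrite inE eqxx.
case/andP: Oa => as_ Oa.
have ah : a \in h by rewrite -(perm_mem pe) inE mem_rcons inE eqxx orbT.
have bh : b \in h by rewrite -(perm_mem pe) inE eqxx.
have nab : a != b.
  by apply: contraNneq nOb => <-; rewrite as_.
have eab : e a b by move: cp; rewrite /= rcons_path last_rcons => /andP[].
have bs : b \notin s.
  by apply/negP=> bs; move: (allP Oa _ bs); rewrite /= (tour b a bh ah) ?eab // eq_sym.
have [Ob|Ib] := dich b bh bs; first by rewrite bs Ob in nOb.
have zs : z \in s by rewrite !inE eqxx !orbT.
have zh := sh _ zs.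
exists [:: x, a, b, z & s']; split.
- by rewrite /= -ss.
- move: us as_ bs; rewrite /s /= !inE !negb_or (eq_sym a x) (eq_sym b x).
  by move=> /and4P[/and3P[_ -> ->] /andP[_ _] -> ->]
    /and4P[-> _ -> ->] /and4P[-> _ -> ->]; rewrite nab.
- move: cs; rewrite /s /= => /and3P[_ _ ->]; rewrite (allP Oa) ?inE ?eqxx //= eab
    (tour b z bh zh) ?(allP Ib) //.
  by apply: contraNneq bs => ->.
- by move=> t; rewrite !inE => /or4P[/eqP->|/eqP->|/eqP->|H] //; apply: sh;
    rewrite !inE ?eqxx // H !orbT.
Qed.

End Moon.

(** * Rainbow cycles as periodic sequences over the integers *)

Local Open Scope Z_scope.

(** Periodic indexing by all integers avoids reductions modulo [M]: positions in a window of length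
    [M] are compared by linear arithmetic. *)
Record rainbow_ring (V C : Type) (c : V -> V -> C) (M : Z) (v : Z -> V) : Prop := {
  ring_per : forall i, v (i + M) = v i;
  ring_inj : forall i j, i < j < i + M -> v i <> v j;
  ring_col : forall i j, i < j < i + M -> c (v i) (v (i + 1)) <> c (v j) (v (j + 1)) }.

Section Rings.
Context (V C : Type) (c : V -> V -> C).

Lemma rainbow_cycle_ring m : rainbow_cycle c m ->
  exists v, rainbow_ring c (Z.of_nat m) v.
Proof.
move=> [m3 [v0 [vinj cinj]]]; set M := Z.of_nat m.
have M0 : 3 <= M by rewrite /M; lia.
pose r z := Z.to_nat (z mod M).
have rb z : (r z < m)%N by have := Z.mod_pos_bound z M; rewrite /r /M in M0 *; lia.
have rinj i j : i < j < i + M -> r i <> r j.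
  move=> ij E.
  have bi := Z.mod_pos_bound i M; have bj := Z.mod_pos_bound j M; rewrite /r in E.
  have di := Z.div_mod i M; have dj := Z.div_mod j M.
  have Eq : j - i = M * (j / M - i / M) by lia.
  have [?|?] : j / M - i / M <= 0 \/ 1 <= j / M - i / M by lia.
    by nia.
  by nia.
have rS z : r (z + 1) = ((r z).+1 %% m)%N.
  have E : (z + 1) mod M = (z mod M + 1) mod M by rewrite Zplus_mod_idemp_l.
  rewrite /r E; have := Z.mod_pos_bound z M; move: (z mod M) => x xb.
  have [xM|xM] := Z.eq_dec (x + 1) M.
    by rewrite xM Z_mod_same_full (_ : (Z.to_nat x).+1 = m) ?modnn //;
      rewrite /M in M0 xM; lia.
  rewrite Z.mod_small ?modn_small; rewrite /M in M0 xM xb *; lia.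
exists (fun z => v0 (r z)); split.
- by move=> i; rewrite /r -{1}(Z.mul_1_l M) Z_mod_plus_full.
- by move=> i j ij E; apply: (rinj i j ij); apply: vinj.
- by move=> i j ij; rewrite !rS => E; apply: (rinj i j ij); apply: cinj E.
Qed.

Context (M : Z) (v : Z -> V) (Hv : rainbow_ring c M v).

(** Distinct positions less than [M] apart are distinct modulo [M]. Closure is required of the
    vertices only, since [P N] and [P 0] may differ by a period. *)
Lemma ring_rainbow_cycle (N : Z) (P : Z -> Z) : 3 <= N ->
  (forall i j, 0 <= i < j -> j < N -> P i <> P j /\ Z.abs (P i - P j) < M) ->
  v (P N) = v (P 0) ->
  (forall i j, 0 <= i < j -> j < N ->
     c (v (P i)) (v (P (i + 1))) <> c (v (P j)) (v (P (j + 1)))) ->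
  rainbow_cycle c (Z.to_nat N).
Proof.
move=> N3 Pinj PN Pcol; split; first lia.
have step k : (k < Z.to_nat N)%N ->
  v (P (Z.of_nat (k.+1 %% Z.to_nat N)%N)) = v (P (Z.of_nat k + 1)).
  move=> kN; have [E|E] := eqVneq k.+1 (Z.to_nat N).
    by rewrite E modnn -PN; congr (v (P _)); lia.
  by rewrite modn_small; [congr (v (P _)); lia|lia].
have vneq i j : 0 <= i < j -> j < N -> v (P i) <> v (P j).
  move=> ij jN; have [ne ab] := Pinj i j ij jN.
  have [lt|gt] : P i < P j \/ P j < P i by lia.
  - by apply: (ring_inj Hv); lia.
  - by move=> E; apply: (@ring_inj _ _ _ _ _ Hv (P j) (P i)) => //; lia.
exists (fun k => v (P (Z.of_nat k))); split=> i j iN jN.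
  have [//|[lt|gt]] : i = j \/ (i < j)%coq_nat \/ (j < i)%coq_nat by lia.
    by move=> E; case: (@vneq (Z.of_nat i) (Z.of_nat j)) => //; lia.
  by move=> E; case: (@vneq (Z.of_nat j) (Z.of_nat i)) => //; lia.
rewrite !step //.
have [//|[lt|gt]] : i = j \/ (i < j)%coq_nat \/ (j < i)%coq_nat by lia.
  by move=> E; case: (@Pcol (Z.of_nat i) (Z.of_nat j)) => //; lia.
by move=> E; case: (@Pcol (Z.of_nat j) (Z.of_nat i)) => //; lia.
Qed.

Definition edge_color i := c (v i) (v (i + 1)).

Lemma edge_color_inj i j : i <> j -> Z.abs (i - j) < M -> edge_color i <> edge_color j.
Proof.
move=> ne ab; have [lt|gt] : i < j \/ j < i by lia.
- by apply: (ring_col Hv); lia.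
- by move=> E; apply: (@ring_col _ _ _ _ _ Hv j i) => //; lia.
Qed.

(* [P i] is the ring position of the [i]-th vertex, and [Q i] is a ring edge with
   the colour of the [i]-th edge. *)
Lemma ring_labelled_cycle (N : Z) (P Q : Z -> Z) : 3 <= N ->
  (forall i j, 0 <= i < j -> j < N -> P i <> P j /\ Z.abs (P i - P j) < M) ->
  v (P N) = v (P 0) ->
  (forall i, 0 <= i < N -> c (v (P i)) (v (P (i + 1))) = edge_color (Q i)) ->
  (forall i j, 0 <= i < j -> j < N -> Q i <> Q j /\ Z.abs (Q i - Q j) < M) ->
  rainbow_cycle c (Z.to_nat N).
Proof.
move=> N3 Pinj PN PQ Qinj; apply: ring_rainbow_cycle Pinj PN _ => // i j ij jN.
by have [ne ab] := Qinj i j ij jN; rewrite !PQ; [apply: edge_color_inj|lia|lia].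
Qed.

(** The main tool: a rainbow path on [N] vertices cannot close to a rainbow [N]-cycle, so its
    closing edge repeats a colour of the path. Two such paths with the same ends confine that colour
    to the intersection of their colour sets. *)
Lemma closing_color (N : Z) (P Q : Z -> Z) : 3 <= N ->
  ~ rainbow_cycle c (Z.to_nat N) ->
  (forall i j, 0 <= i < j -> j < N -> P i <> P j /\ Z.abs (P i - P j) < M) ->
  (forall i, 0 <= i < N - 1 -> c (v (P i)) (v (P (i + 1))) = edge_color (Q i)) ->
  (forall i j, 0 <= i < j -> j < N - 1 -> Q i <> Q j /\ Z.abs (Q i - Q j) < M) ->
  exists i, 0 <= i < N - 1 /\ c (v (P (N - 1))) (v (P 0)) = edge_color (Q i).
Proof.
move=> N3 noN Pinj PQ Qinj; apply: NNPP => H; apply: noN.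
pose P' i := if i =? N then P 0 else P i.
have P'E i : 0 <= i < N -> P' i = P i by rewrite /P'; case: Z.eqb_spec => //; lia.
have P'N : P' N = P 0 by rewrite /P' Z.eqb_refl.
apply: (@ring_rainbow_cycle N P') => //.
- by move=> i j ij jN; rewrite !P'E; [apply: Pinj|lia|lia].
- by rewrite P'N P'E //; lia.
move=> i j ij jN; rewrite !(P'E i) ?(P'E j) ?(P'E (i + 1)); try lia.
rewrite PQ; last lia.
have [E|E] := Z.eq_dec j (N - 1).
  rewrite E (_ : N - 1 + 1 = N); last lia.
  by rewrite P'N => E2; apply: H; exists i; split; [lia|].
rewrite P'E ?PQ; try lia.
by have [|ne ab] := Qinj i j ij; [lia|apply: edge_color_inj].
Qed.

End Rings.

(** The explicit paths below are piecewise linear in the index, so splitting the comparisons leaves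
    linear arithmetic. *)
Ltac leb_lia := intros;
  repeat match goal with
  | |- context [Z.leb ?a ?b] => destruct (Z.leb_spec a b)
  | H : context [Z.leb ?a ?b] |- _ => destruct (Z.leb_spec a b)
  end; lia.

Ltac ifs := repeat match goal with
  | |- context [Z.leb ?a ?b] => destruct (Z.leb_spec a b); try lia
  end.

Lemma Z_switch (P : Z -> Prop) x y : x <= y -> P x -> ~ P y ->
  exists a, x <= a < y /\ P a /\ ~ P (a + 1).
Proof.
move=> xy Px nPy; apply: NNPP => H.
suff: forall k, 0 <= k -> x + k <= y -> P (x + k).
  by move=> /(_ (y - x)); rewrite Zplus_minus => K; apply: nPy; apply: K; lia.
apply: natlike_ind => [|k k0 IH] ky; first by rewrite Z.add_0_r.
apply: NNPP => nP; apply: H; exists (x + k); split; first lia.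
by split; [apply: IH; lia|rewrite -Z.add_assoc].
Qed.

(** * Colours of chords when there is no rainbow cycle of length [d + 2] *)

Section Chords.
Context (V C : Type) (c : V -> V -> C) (Hc : coloring_sym c).
Context (d : Z) (d_gt0 : 1 <= d) (noN : ~ rainbow_cycle c (Z.to_nat (d + 2))).

Lemma edge_color_per M v (Hv : rainbow_ring c M v) i : edge_color c v (i + M) = edge_color c v i.
Proof.
rewrite /edge_color (_ : i + M + 1 = i + 1 + M); last lia.
by rewrite !(ring_per Hv).
Qed.

Lemma chord_color M v (Hv : rainbow_ring c M v) i : d + 2 <= M ->
  exists j, i <= j <= i + d /\ c (v i) (v (i + d + 1)) = edge_color c v j.
Proof.
move=> dM.
have [||||k [kb E]] := @closing_color _ _ _ _ _ Hv (d + 2)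
  (fun k => i + k) (fun k => i + k) _ noN;
  try (intros; lia).
- by move=> k _; rewrite /edge_color Z.add_assoc.
exists (i + k); split; first lia.
by rewrite Hc -E; congr (c (v _) (v _)); lia.
Qed.

Lemma rainbow_cycle_subd (m : nat) : d + 2 < Z.of_nat m ->
  rainbow_cycle c m -> rainbow_cycle c (Z.to_nat (Z.of_nat m - d)).
Proof.
move=> dM /rainbow_cycle_ring[v]; set M := Z.of_nat m => Hv.
have [|j [jb E]] := chord_color Hv 0; first by rewrite /M; lia.
apply: (@ring_labelled_cycle _ _ _ _ _ Hv _ (fun k => if k <=? 0 then 0 else k + d)
          (fun k => if k <=? 0 then j else k + d)).
- lia.
- leb_lia.
- case: Z.leb_spec; first lia; move=> _.
  by rewrite -(ring_per Hv 0) /=; congr v; lia.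
- move=> k kb; have [k0|k0] : k = 0 \/ 0 < k by lia.
    by ifs; rewrite -E; congr (c (v _) (v _)); lia.
  by ifs; rewrite /edge_color; congr (c (v _) (v _)); lia.
- leb_lia.
Qed.

(** * First- and last-coloured chords, and the exclusion of a mixture *)

Section Ring.
Context (M : Z) (v : Z -> V) (Hv : rainbow_ring c M v) (dM : 12 * d <= M).
Context (d_ge3 : 3 <= d).
Local Notation e := (edge_color c v).
Context (noX : ~ rainbow_cycle c (Z.to_nat (M - 2 * d + 2))).

Let first_colored i := c (v i) (v (i + d + 1)) = e i.
Let last_colored i := c (v i) (v (i + d + 1)) = e (i + d).

(* Otherwise the crossing chords from [i] and [i + d] give a rainbow cycle of
   length [M - 2 d + 2]. *)
Lemma last_or_next_first_colored i : last_colored i \/ first_colored (i + d).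
Proof.
apply: NNPP => H; apply: noX.
have [|j [jb Ej]] := chord_color Hv i; first lia.
have [|k [kb Ek]] := chord_color Hv (i + d); first lia.
have jn : j <> i + d by move=> E; apply: H; left; rewrite /last_colored Ej E.
have kn : k <> i + d by move=> E; apply: H; right; rewrite /first_colored Ek E.
(* The cycle visits [i], [i + d + 1], [i + d], [i + 2 * d + 1] and then follows the ring to [i + M].
   The chord colours [j] and [k] lie on either side of the edge [i + d], which is traversed
   backwards. *)
apply: (@ring_labelled_cycle _ _ _ _ _ Hv _
  (fun t => if t <=? 0 then i else if t <=? 1 then i + d + 1 else
            if t <=? 2 then i + d else i + 2 * d + t - 2)
  (fun t => if t <=? 0 then j else if t <=? 1 then i + d else
            if t <=? 2 then k else i + 2 * d + t - 2)).
- lia.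
- leb_lia.
- by ifs; rewrite -(ring_per Hv i); congr v; lia.
- move=> t tb; have [t0|[t1|[t2|t3]]] : t = 0 \/ t = 1 \/ t = 2 \/ 3 <= t by lia.
  + by ifs; rewrite -Ej; congr (c (v _) (v _)); lia.
  + by ifs; rewrite Hc /edge_color; congr (c (v _) (v _)); lia.
  + by ifs; rewrite -Ek; congr (c (v _) (v _)); lia.
  + by ifs; rewrite /edge_color; congr (c (v _) (v _)); lia.
- leb_lia.
Qed.

Lemma first_colored_not_last i : first_colored i -> ~ last_colored i.
Proof. by rewrite /first_colored /last_colored => -> E; apply: (edge_color_inj Hv _ _ E); lia. Qed.

Lemma first_colored_addM i k : 0 <= k -> first_colored (i + k * M) <-> first_colored i.
Proof.
move: k; apply: natlike_ind => [|k k0 IH]; first by rewrite Z.add_0_r.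
rewrite -IH /first_colored (_ : i + Z.succ k * M = i + k * M + M); last lia.
rewrite (edge_color_per Hv) (ring_per Hv)
  (_ : i + k * M + M + d + 1 = i + k * M + d + 1 + M); last lia.
by rewrite (ring_per Hv).
Qed.

(* Taking [k] a multiple of [M] returns to the starting point. *)
Lemma first_colored_of_not_last i k : 1 <= k -> ~ last_colored i -> first_colored (i + k * d).
Proof.
move=> k1 nL; rewrite (_ : k = k - 1 + 1); last lia.
have : 0 <= k - 1 by lia.
move: (k - 1); apply: natlike_ind => [|j j0 IH].
  by have [//|] := last_or_next_first_colored i; rewrite (_ : 0 + 1 = 1) // Z.mul_1_l.
have [/(first_colored_not_last IH)//|] := last_or_next_first_colored (i + (j + 1) * d).
by rewrite (_ : i + (Z.succ j + 1) * d = i + (j + 1) * d + d) //; lia.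
Qed.

Lemma last_or_first_colored i : last_colored i \/ first_colored i.
Proof.
have [|nL] := classic (last_colored i); [by left|right].
rewrite -(@first_colored_addM i d); last lia.
rewrite Z.mul_comm; apply: first_colored_of_not_last => //; lia.
Qed.

(** For the forward direction, [M - 1] further steps of [d] lead from [i + d] to [i + d * M], which
    is [i] modulo [M]. *)
Lemma first_colored_addd i : first_colored (i + d) <-> first_colored i.
Proof.
split=> [H|H].
  have := @first_colored_of_not_last (i + d) (M - 1) _ (first_colored_not_last H).
  rewrite (_ : i + d + (M - 1) * d = i + d * M); last lia.
  by rewrite first_colored_addM; [apply; lia|lia].
by have := @first_colored_of_not_last i 1 _ (first_colored_not_last H);
  rewrite Z.mul_1_l; apply; lia.
Qed.

Lemma last_colored_not_first i : last_colored i <-> ~ first_colored i.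
Proof. by split; [move=> L /first_colored_not_last|case: (last_or_first_colored i)]. Qed.

Lemma last_colored_addd i : last_colored (i + d) <-> last_colored i.
Proof. by rewrite !last_colored_not_first first_colored_addd. Qed.

(** Induction on [k]: two rainbow paths join [i] to [i + (k + 1) * d + 1]. One starts with the chord
    to [i + k * d + 1] and then follows the ring; the other follows the ring to [i + d] and ends
    with a chord. For [k >= 1] their only common colour is [e i]. *)
Lemma first_colored_chord k : 0 <= k -> forall i, first_colored i -> k * d + 1 < M ->
  c (v i) (v (i + k * d + 1)) = e i.
Proof.
move: k; apply: natlike_ind => [|k k0 IH] i Fi kM; first by rewrite Z.mul_0_l Z.add_0_r.
have [->|k1] : k = 0 \/ 1 <= k by lia.
  by rewrite (_ : Z.succ 0 * d = d) //; lia.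
have kd : d <= k * d by nia.
have [||||s [sb Es]] := @closing_color _ _ _ _ _ Hv (d + 2)
  (fun t => if t <=? 0 then i else i + k * d + t)
  (fun t => if t <=? 0 then i else i + k * d + t) _ noN; try leb_lia.
- move=> t tb; have [->|t1] : t = 0 \/ 1 <= t by lia.
    by rewrite /=; apply: IH => //; lia.
  rewrite /edge_color; congr (c (v _) (v _)); leb_lia.
have [||||r [rb Er]] := @closing_color _ _ _ _ _ Hv (d + 2)
  (fun t => if t <=? d then i + t else i + k * d + t)
  (fun t => i + t) _ noN; try leb_lia.
- move=> t tb; have [->|t1] : t = d \/ t < d by lia.
    have -> : d <=? d = true by lia.
    have -> : d + 1 <=? d = false by lia.
    rewrite (_ : i + k * d + (d + 1) = i + d + k * d + 1); last lia.
    by apply: IH; [rewrite first_colored_addd|lia].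
  rewrite /edge_color; congr (c (v _) (v _)); leb_lia.
have E t : t = i + Z.succ k * d + 1 -> c (v i) (v t) = e i.
  move=> Et.
  have E1 : c (v i) (v t) = e (i + r) by rewrite Hc -Er; congr (c (v _) (v _)); leb_lia.
  have E2 : c (v i) (v t) = e (if s <=? 0 then i else i + k * d + s).
    by rewrite Hc -Es; congr (c (v _) (v _)); leb_lia.
  move: E2; case: Z.leb_spec => // s0; rewrite E1 => /(edge_color_inj Hv) H;
  exfalso; apply: H; lia.
by apply: E.
Qed.

(** The same two paths serve; with last-edge colours, the only common colour is
    [e (i + k * d + d)]. *)
Lemma last_colored_chord k : 0 <= k -> forall i, last_colored i -> k * d + 1 < M ->
  c (v i) (v (i + k * d + 1)) = e (i + k * d).
Proof.
move: k; apply: natlike_ind => [|k k0 IH] i Fi kM; first by rewrite Z.mul_0_l Z.add_0_r.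
have [->|k1] : k = 0 \/ 1 <= k by lia.
  by rewrite (_ : Z.succ 0 * d = d) //; lia.
have kd : d <= k * d by nia.
have [||||s [sb Es]] := @closing_color _ _ _ _ _ Hv (d + 2)
  (fun t => if t <=? 0 then i else i + k * d + t)
  (fun t => i + k * d + t) _ noN; try leb_lia.
- move=> t tb; have [->|t1] : t = 0 \/ 1 <= t by lia.
    by rewrite /= Z.add_0_r; apply: IH => //; lia.
  rewrite /edge_color; congr (c (v _) (v _)); leb_lia.
have [||||r [rb Er]] := @closing_color _ _ _ _ _ Hv (d + 2)
  (fun t => if t <=? d then i + t else i + k * d + t)
  (fun t => if t + 1 <=? d then i + t else i + k * d + t) _ noN; try leb_lia.
- move=> t tb; have [->|t1] : t = d \/ t < d by lia.
    have -> : d <=? d = true by lia.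
    have -> : d + 1 <=? d = false by lia.
    rewrite (_ : i + k * d + (d + 1) = i + d + k * d + 1); last lia.
    rewrite (_ : i + k * d + d = i + d + k * d); last lia.
    by apply: IH; [rewrite last_colored_addd|lia].
  rewrite /edge_color; congr (c (v _) (v _)); leb_lia.
have E t : t = i + Z.succ k * d + 1 -> c (v i) (v t) = e (i + k * d + d).
  move=> Et.
  have E1 : c (v i) (v t) = e (i + k * d + s) by rewrite Hc -Es; congr (c (v _) (v _)); leb_lia.
  have E2 : c (v i) (v t) = e (if r + 1 <=? d then i + r else i + k * d + r).
    by rewrite Hc -Er; congr (c (v _) (v _)); leb_lia.
  move: (E2); case: Z.leb_spec => [r0|r0]; rewrite E1.
    by move=> /(edge_color_inj Hv) H; exfalso; apply: H; lia.
  by move=> ->; congr edge_color; lia.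
by rewrite E //; congr edge_color; lia.
Qed.

(* The two paths from [x] to [x + 6 d - 3] follow the ring except for a zigzag
   at [a, a + 1, a + 2]; they differ in taking a jump of [3 d] at the end or at
   the start, so their colours are disjoint. *)
Lemma no_long_window x a : x <= a <= x + d - 5 ->
  last_colored x -> first_colored (x - 4) -> last_colored a -> first_colored (a + 1) -> False.
Proof.
move=> ab Lx Fx La Fa; set s := a - x.
have Fx3 : first_colored (x + 3 * d - 4).
  by rewrite (_ : x + 3 * d - 4 = x - 4 + d + d + d) ?first_colored_addd //; lia.
have Lad : last_colored (a + d) by rewrite last_colored_addd.
have Fad j : 0 <= j -> first_colored (a + 1 + j * d).
  move: j; apply: natlike_ind => [|j j0 IH]; first by rewrite Z.add_0_r.
  by rewrite (_ : a + 1 + Z.succ j * d = a + 1 + j * d + d) ?first_colored_addd //; lia.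
have Lj i j : 0 <= j -> last_colored i -> last_colored (i + j * d).
  move=> j0 Li; move: j j0; apply: natlike_ind => [|j j0 IH]; first by rewrite Z.add_0_r.
  by rewrite (_ : i + Z.succ j * d = i + j * d + d) ?last_colored_addd //; lia.
(* The zigzag is [a + 1], [a + d + 2], [a + d + 1], [a + d], [a + 2 * d + 1]: a first-coloured
   chord, two ring edges backwards, a last-coloured chord. It is over by [t = s + 5 <= d], and [P d]
   is [x + 3 * d - 4]. *)
pose P t := if t <=? s + 1 then x + t else if t <=? s + 2 then a + 2 + d else
  if t <=? s + 3 then a + 1 + d else if t <=? s + 4 then a + d else x + 2 * d + t - 4.
pose Q t := if t <=? s + 1 then x + t else if t <=? s + 2 then a + 1 + d else
  if t <=? s + 3 then a + d else if t <=? s + 4 then a + 2 * d else x + 2 * d + t - 4.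
have PQ j t : 0 <= j <= 3 -> 0 <= t < d ->
    c (v (P t + j * d)) (v (P (t + 1) + j * d)) = e (Q t + j * d).
  move=> jb tb; have jd : 0 <= j * d <= 3 * d by nia.
  rewrite /P /Q /s.
  have [?|[?|[?|[?|[?|?]]]]] : t <= s \/ t = s + 1 \/ t = s + 2 \/
    t = s + 3 \/ t = s + 4 \/ s + 5 <= t by lia.
  - by ifs; rewrite /edge_color; congr (c (v _) (v _)); lia.
  - ifs; rewrite (_ : x + t + j * d = a + 1 + j * d); last lia.
    by rewrite -(@first_colored_chord 1) //; [congr (c (v _) (v _)); lia|apply: Fad; lia|lia].
  - by ifs; rewrite Hc /edge_color; congr (c (v _) (v _)); lia.
  - by ifs; rewrite Hc /edge_color; congr (c (v _) (v _)); lia.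
  - ifs; rewrite (_ : a + 2 * d + j * d = a + d + j * d + 1 * d); last lia.
    by rewrite -(@last_colored_chord 1) //;
      [congr (c (v _) (v _)); lia|apply: Lj => //; lia|lia].
  - by ifs; rewrite /edge_color; congr (c (v _) (v _)); lia.
have [||||i1 [i1b E1]] := @closing_color _ _ _ _ _ Hv (d + 2)
  (fun t => if t <=? d then P t else x + 6 * d - 3) Q _ noN.
- lia.
- rewrite /P /s; leb_lia.
- move=> t tb; have [td|td] : t = d \/ t < d by lia.
    rewrite /P /Q; ifs; rewrite (_ : x + 2 * d + t - 4 = x + 3 * d - 4); last lia.
    by rewrite -(@first_colored_chord 3) //; [congr (c (v _) (v _)); lia|lia].
  have := PQ 0 t; rewrite Z.mul_0_l !Z.add_0_r => <-; [|lia|lia].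
  by ifs.
- rewrite /Q /s; leb_lia.
have [||||i2 [i2b E2]] := @closing_color _ _ _ _ _ Hv (d + 2)
  (fun t => if t <=? 0 then x else if t <=? d then P t + 3 * d else x + 6 * d - 3)
  (fun t => Q t + 3 * d) _ noN.
- lia.
- rewrite /P /s; leb_lia.
- move=> t tb; have [t0|[td|td]] : t = 0 \/ t = d \/ 0 < t < d by lia.
  + rewrite /P /Q; ifs; rewrite (_ : x + t + 3 * d = x + 3 * d); last lia.
    by rewrite -(@last_colored_chord 3) //; [congr (c (v _) (v _)); lia|lia].
  + by rewrite /P /Q /s; ifs; rewrite /edge_color; congr (c (v _) (v _)); lia.
  + have <- := PQ 3 t; [|lia|lia].
    by ifs.
- rewrite /Q /s; leb_lia.
have EQ : e (Q i1) = e (Q i2 + 3 * d).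
  rewrite -E1 -E2; congr (c (v _) (v _)); rewrite /P; ifs.
by apply: (edge_color_inj Hv _ _ EQ); rewrite /Q /s; leb_lia.
Qed.

(** For [d = 3] the window of [no_long_window] is empty. Instead, two rainbow paths on five vertices
    join [a] to [a + 3], with ring colours at offsets 0, 1, 3, 4 and 6, 7, 9, 10. *)
Lemma no_switch3 a : d = 3 -> last_colored a -> first_colored (a + 1) -> False.
Proof.
move=> d3 La Fa.
have La3 : last_colored (a + 3) by rewrite -d3 last_colored_addd.
have Fa7 : first_colored (a + 7) by rewrite (_ : a + 7 = a + 1 + d + d) ?first_colored_addd //; lia.
have [||||i1 [i1b E1]] := @closing_color _ _ _ _ _ Hv (d + 2)
  (fun t => if t <=? 1 then a + t else a + 7 - t)
  (fun t => if t <=? 1 then a + t else a + 6 - t) _ noN; try leb_lia.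
- move=> t tb; have [t0|[t1|t2]] : t = 0 \/ t = 1 \/ 2 <= t by lia.
  + by ifs; rewrite /edge_color; congr (c (v _) (v _)); lia.
  + ifs; rewrite (_ : a + t = a + 1); last lia.
    by rewrite -(@first_colored_chord 1) //; [congr (c (v _) (v _)); lia|lia].
  + by ifs; rewrite Hc /edge_color; congr (c (v _) (v _)); lia.
have [||||i2 [i2b E2]] := @closing_color _ _ _ _ _ Hv (d + 2)
  (fun t => if t <=? 0 then a else if t <=? 1 then a + 7 else
            if t <=? 2 then a + 11 else if t <=? 3 then a + 10 else a + 3)
  (fun t => if t <=? 0 then a + 6 else if t <=? 1 then a + 7 else
            if t <=? 2 then a + 10 else a + 9) _ noN; try leb_lia.
- move=> t tb; have [t0|[t1|[t2|t3]]] : t = 0 \/ t = 1 \/ t = 2 \/ t = 3 by lia.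
  + ifs; rewrite (_ : a + 6 = a + 2 * d); last lia.
    by rewrite -(@last_colored_chord 2) //; [congr (c (v _) (v _)); lia|lia].
  + ifs; rewrite -(@first_colored_chord 1 _ (a + 7)) //; [congr (c (v _) (v _)); lia|lia].
  + by ifs; rewrite Hc /edge_color; congr (c (v _) (v _)); lia.
  + ifs; rewrite (_ : a + 9 = a + 3 + 2 * d); last lia.
    by rewrite Hc -(@last_colored_chord 2) //; [congr (c (v _) (v _)); lia|lia].
have EE : c (v (a + 3)) (v a) = c (v (a + 3)) (v a) by [].
move: {1}(c _ _) EE => g Eg.
have E1' : g = e (if i1 <=? 1 then a + i1 else a + 6 - i1).
  by rewrite Eg -E1; congr (c (v _) (v _)); leb_lia.
have E2' : g = e (if i2 <=? 0 then a + 6 else if i2 <=? 1 then a + 7 else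
            if i2 <=? 2 then a + 10 else a + 9).
  by rewrite Eg -E2; congr (c (v _) (v _)); leb_lia.
rewrite E1' in E2'; apply: (edge_color_inj Hv _ _ E2'); leb_lia.
Qed.

Context (d_odd : Z.Odd d).

Lemma no_switch a : last_colored a -> first_colored (a + 1) -> False.
Proof.
move=> La Fa; have [d3|d5] : d = 3 \/ 5 <= d by have [k dk] := d_odd; lia.
  exact: no_switch3 d3 La Fa.
(* [4] is invertible modulo the odd number [d]. *)
have [x [Lx Fx]] : exists x, last_colored x /\ first_colored (x - 4).
  apply: NNPP => H.
  have step x : last_colored x -> last_colored (x - 4).
    by move=> Lx; rewrite last_colored_not_first => Fx; apply: H; exists x.
  have steps k : 0 <= k -> last_colored (a - 4 * k).
    move: k; apply: natlike_ind => [|k k0 IH]; first by rewrite Z.sub_0_r.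
    by rewrite (_ : a - 4 * Z.succ k = a - 4 * k - 4); [apply: step|lia].
  have [k dk] := d_odd.
  have : last_colored (a + 1); last by apply: first_colored_not_last.
  (* As [d] is [4 * j + 1] or [4 * j + 3], steps of [- 4] and of [d] lead from [a] to [a + 1]. *)
  have [j [kj|kj]] : exists j, k = 2 * j \/ k = 2 * j + 1.
    exists (k / 2); have := Z.div_mod k 2; have := Z.mod_pos_bound k 2; lia.
  - rewrite (_ : a + 1 = a - 4 * j + d) ?last_colored_addd; [apply: steps|]; lia.
  - rewrite (_ : a + 1 = a - 4 * (3 * j + 2) + d + d + d) ?last_colored_addd; [apply: steps|]; lia.
have FxD : ~ last_colored (x + d - 4).
  rewrite last_colored_not_first => H; apply: H.
  by rewrite (_ : x + d - 4 = x - 4 + d) ?first_colored_addd //; lia.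
have [|b [bb [Lb nLb]]] := @Z_switch last_colored x (x + d - 4) _ Lx FxD; first lia.
apply: (@no_long_window x b) => //; first lia.
by have [|] := last_or_first_colored (b + 1).
Qed.

(** If both kinds occur, shifting by a multiple of [d] puts a first-coloured chord after a
    last-coloured one, and a switch excluded by [no_switch] lies between them. *)
Lemma last_or_first_colored_all : (forall i, last_colored i) \/ (forall i, first_colored i).
Proof.
have [H|H] := classic (exists i, last_colored i); last first.
  by right=> i; have [L|//] := last_or_first_colored i; case: H; exists i.
left=> j; have [i Li] := H.
apply: NNPP => nLj.
pose k := Z.abs (i - j) + 1.
have nLk : ~ last_colored (j + k * d)
  by apply/first_colored_not_last/first_colored_of_not_last; rewrite // /k; lia.
have [|b [bb [Lb nLb]]] := @Z_switch last_colored i (j + k * d) _ Li nLk;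
  first by rewrite /k; nia.
by apply: (@no_switch b Lb); have [|] := last_or_first_colored (b + 1).
Qed.

End Ring.

(** * Chords of a single kind: every edge takes the colour of an endpoint *)

Section Tournament.
Context (M : Z) (v : Z -> V) (Hv : rainbow_ring c M v) (dM : 12 * d <= M).
Context (d_odd : Z.Odd d).
Local Notation e := (edge_color c v).
Context (last_color : forall k i, 0 <= k -> k * d + 1 < M ->
  c (v i) (v (i + k * d + 1)) = e (i + k * d)).

(* The edge closes two pairs of directed paths issuing from a common source;
   they share no colour except those of the two endpoints. *)
Lemma chord_endpoint_color_near u y : 0 < y -> 2 * y <= M ->
  c (v u) (v (u + y)) = e (u - 1) \/ c (v u) (v (u + y)) = e (u + y - 1).
Proof.
move=> y0 yM.
(* With [d = 2 * h + 1], [h + 1] inverts 2 modulo [d], so [2 * l2] can be made congruent to [y + 1].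
   The directed paths to [u + y] and [u] then have [l2] and [l1] edges, [d + 1] in all, and every
   jump has span 1 modulo [d]. *)
have [l2 [q [l2b Eq]]] : exists l2 q, 1 <= l2 <= d /\ y + d + 1 - 2 * l2 = q * d.
  have [h dh] := d_odd.
  have D := Z.div_mod ((1 + y) * (h + 1) - 1) d.
  have B := Z.mod_pos_bound ((1 + y) * (h + 1) - 1) d.
  exists (((1 + y) * (h + 1) - 1) mod d + 1).
  exists (2 * (((1 + y) * (h + 1) - 1) / d) - y); split; first lia.
  move: D B; move: (_ / d) (_ mod d) => a b D B; nia.
have q0 : 0 <= q by nia.
set l1 := d + 1 - l2.
have [||||i1 [i1b E1]] := @closing_color _ _ _ _ _ Hv (d + 2)
  (fun t => if t <=? 0 then u + y else if t <=? l2 then u - l1 - d + l2 - t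
            else u - l1 + t - l2)
  (fun t => if t <=? 0 then u + y - 1 else if t + 1 <=? l2 then u - l1 - d + l2 - 1 - t
            else u - l1 + t - l2) _ noN; try (rewrite /l1; leb_lia).
- rewrite /l1 => t tb.
  have [?|[?|[?|?]]] : t = 0 \/ 1 <= t < l2 \/ t = l2 \/ l2 < t by lia.
  + ifs; rewrite Hc (_ : u + y - 1 = u - l1 - d + l2 - 1 + (q + 1) * d);
      last (rewrite /l1; lia).
    by rewrite -last_color; [congr (c (v _) (v _)); rewrite /l1; lia|lia|lia].
  + by ifs; rewrite Hc /edge_color; congr (c (v _) (v _)); lia.
  + ifs; rewrite (_ : u - (d + 1 - l2) + t - l2 = u - l1 - d + 1 * d);
      last (rewrite /l1; lia).
    by rewrite -last_color; [congr (c (v _) (v _)); rewrite /l1; lia|lia|lia].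
  + by ifs; rewrite /edge_color; congr (c (v _) (v _)); lia.
(* The second source lies [3 * d] further back, which keeps the inner colours of the two pairs
   apart. The path to [u] ends with a jump, so that it meets no inner colour of the first pair. *)
have [||||i2 [i2b E2]] := @closing_color _ _ _ _ _ Hv (d + 2)
  (fun t => if t <=? 0 then u + y else if t <=? l2 then u - l1 - 4 * d + l2 - t
            else if t <=? d then u - 2 * d - l1 + t - l2 else u)
  (fun t => if t <=? 0 then u + y - 1 else if t + 1 <=? l2 then u - l1 - 4 * d + l2 - 1 - t
            else if t + 1 <=? d then u - 2 * d - l1 + t - l2 else u - 1) _ noN;
  try (rewrite /l1; leb_lia).
- rewrite /l1 => t tb.
  have [?|[?|[?|[?|[?|?]]]]] : t = 0 \/ 1 <= t < l2 \/ t = l2 /\ l2 < d \/ t = d /\ l2 = d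
    \/ l2 < t < d \/ l2 < t /\ t = d by lia.
  + ifs; rewrite Hc (_ : u + y - 1 = u - l1 - 4 * d + l2 - 1 + (q + 4) * d);
      last (rewrite /l1; lia).
    by rewrite -last_color; [congr (c (v _) (v _)); rewrite /l1; lia|lia|lia].
  + by ifs; rewrite Hc /edge_color; congr (c (v _) (v _)); lia.
  + ifs; rewrite (_ : u - 2 * d - (d + 1 - l2) + t - l2 = u - l1 - 4 * d + 2 * d);
      last (rewrite /l1; lia).
    by rewrite -last_color; [congr (c (v _) (v _)); rewrite /l1; lia|lia|lia].
  + ifs; rewrite (_ : u - 1 = u - l1 - 4 * d + 4 * d); last (rewrite /l1; lia).
    by rewrite -last_color; [congr (c (v _) (v _)); rewrite /l1; lia|lia|lia].
  + by ifs; rewrite /edge_color; congr (c (v _) (v _)); lia.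
  + ifs; rewrite (_ : u - 1 = u - 2 * d - 1 + 2 * d); last lia.
    by rewrite -last_color; [congr (c (v _) (v _)); lia|lia|lia].
apply: NNPP => H.
move: E1; set q1 := (X in _ = edge_color c v X) => F1.
move: E2; set q2 := (X in _ = edge_color c v X) => F2.
have {}F1 : c (v u) (v (u + y)) = e q1.
  by rewrite -F1 /l1; congr (c (v _) (v _)); leb_lia.
have {}F2 : c (v u) (v (u + y)) = e q2.
  by rewrite -F2 /l1; congr (c (v _) (v _)); leb_lia.
have n1 : q1 <> u + y - 1 by move=> E; apply: H; right; rewrite F1 E.
have n2 : q1 <> u - 1 by move=> E; apply: H; left; rewrite F1 E.
rewrite F1 in F2.
by apply: (edge_color_inj Hv _ _ F2); move: n1 n2; rewrite /q1 /q2 /l1; leb_lia.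
Qed.

(** A chord longer than half the ring is short when read from [w] to [u + M]. *)
Lemma chord_endpoint_color u w : 0 < Z.abs (u - w) < M ->
  c (v u) (v w) = e (u - 1) \/ c (v u) (v w) = e (w - 1).
Proof.
wlog uw : u w / u < w.
  move=> H uwM; have [lt|gt] : u < w \/ w < u by lia.
    exact: H.
  by rewrite Hc or_comm; apply: H => //; lia.
move=> uwM; have [le|gt] : 2 * (w - u) <= M \/ M < 2 * (w - u) by lia.
  have := @chord_endpoint_color_near u (w - u).
  by rewrite Zplus_minus; apply; lia.
have := @chord_endpoint_color_near w (u + M - w).
rewrite Zplus_minus (ring_per Hv) (_ : u + M - 1 = u - 1 + M); last lia.
by rewrite (edge_color_per Hv) Hc or_comm; apply; lia.
Qed.

End Tournament.

(** * From a directed cycle in the tournament to a rainbow cycle *)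

Lemma cycle_nth (T : Type) (r : rel T) x0 (s : seq T) i : cycle r s ->
  (i < size s)%N -> r (nth x0 s i) (nth x0 s (i.+1 %% size s)%N).
Proof.
case: s => // x s /(pathP x0) H ilt.
have := H i; rewrite size_rcons => /(_ ilt).
rewrite -rcons_cons nth_rcons ilt nth_rcons /=.
have [->|ne] := eqVneq i (size s); first by rewrite modnn ltnn.
have ils : (i < size s)%N by move: ilt ne => /=; lia.
by rewrite modn_small ?ltnS // ils.
Qed.

Lemma cycle_iota (r : rel nat) m :
  (forall i, (i.+1 < m)%N -> r i i.+1) -> r m.-1 0%N -> cycle r (iota 0 m).
Proof.
case: m => // m H H0; rewrite /= rcons_path; apply/andP; split.
  apply/(pathP 0%N) => i; rewrite size_iota => im.
  by rewrite -[0%N :: _]/(iota 0 m.+1) !nth_iota ?add0n //; [apply: H|exact: ltnW].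
by rewrite -nth_last size_iota; case: m H H0 => // m _ H0; rewrite nth_iota.
Qed.

Lemma not_all_last m v (Hv : rainbow_ring c (Z.of_nat m) v) :
  12 * d <= Z.of_nat m -> Z.Odd d ->
  (forall k i, 0 <= k -> k * d + 1 < Z.of_nat m ->
     c (v i) (v (i + k * d + 1)) = edge_color c v (i + k * d)) -> False.
Proof.
move=> dM d_odd lastc.
(* An arc has the colour of the ring edge entering its head, so the arcs of a directed cycle have
   distinct colours. *)
pose arc (i j : nat) : bool :=
  excluded_middle_informative
    (c (v (Z.of_nat i)) (v (Z.of_nat j)) = edge_color c v (Z.of_nat j - 1)).
have arcP i j : reflect
    (c (v (Z.of_nat i)) (v (Z.of_nat j)) = edge_color c v (Z.of_nat j - 1)) (arc i j).
  by rewrite /arc; case: excluded_middle_informative => H; constructor.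
have ei i j : (i < m)%N -> (j < m)%N -> i <> j ->
    edge_color c v (Z.of_nat i - 1) <> edge_color c v (Z.of_nat j - 1).
  by move=> im jm ne; apply: (edge_color_inj Hv); lia.
have tour i j : i \in iota 0 m -> j \in iota 0 m -> i != j -> arc i j = ~~ arc j i.
  rewrite !mem_iota => im jm ne.
  apply/idP/negP => [/arcP ij /arcP|nji].
    by rewrite Hc ij => /ei E; apply: E; lia.
  apply/arcP; have [||//] :=
    @chord_endpoint_color _ _ Hv dM d_odd lastc (Z.of_nat i) (Z.of_nat j).
    by lia.
  by rewrite Hc => /arcP.
have cyc : cycle arc (iota 0 m).
  apply: cycle_iota => [i im|]; apply/arcP; rewrite /edge_color.
    by congr (c (v _) (v _)); lia.
  by rewrite -(ring_per Hv 0) -(ring_per Hv (_ - 1)); congr (c (v _) (v _)); lia.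
have [|s [ss us cs sh]] := tournament_pancyclic tour (iota_uniq _ _)
  cyc (k := Z.to_nat (d + 2)).
  by rewrite size_iota; lia.
have sm i : (i < size s)%N -> (nth 0%N s i < m)%N.
  by move=> /(mem_nth 0%N)/sh; rewrite mem_iota.
apply: noN; split; first lia; rewrite -ss.
have vi i j : (i < m)%N -> (j < m)%N -> v (Z.of_nat i) = v (Z.of_nat j) -> i = j.
  move=> im jm E; have [//|[lt|gt]] : i = j \/ (i < j)%coq_nat \/ (j < i)%coq_nat by lia.
    by case: (@ring_inj _ _ _ _ _ Hv (Z.of_nat i) (Z.of_nat j)) => //; lia.
  by case: (@ring_inj _ _ _ _ _ Hv (Z.of_nat j) (Z.of_nat i)) => //; lia.
exists (fun k => v (Z.of_nat (nth 0%N s k))); split=> i j il jl.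
  by move/vi=> /(_ (sm _ il) (sm _ jl)) /eqP; rewrite nth_uniq // => /eqP.
have s0 : (0 < size s)%N by lia.
have := cycle_nth 0%N cs il => /arcP ->; have := cycle_nth 0%N cs jl => /arcP -> E.
have : nth 0%N s (i.+1 %% size s) == nth 0%N s (j.+1 %% size s).
  apply/eqP; apply: NNPP => ne; apply: (ei _ _ _ _ ne E); apply: sm; exact: ltn_pmod.
rewrite nth_uniq ?ltn_pmod // => /eqP.
have [Ei|ne] := eqVneq i.+1 (size s); have [E'|ne'] := eqVneq j.+1 (size s).
- lia.
- by rewrite Ei modnn modn_small; lia.
- by rewrite E' modnn modn_small; lia.
- by rewrite !modn_small; lia.
Qed.

(** Reversal exchanges the first and last edges of a chord, which reduces the first-coloured case to
    the last-coloured one. *)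
Lemma ring_opp M v : rainbow_ring c M v -> rainbow_ring c M (fun i => v (- i)).
Proof.
move=> Hv; split=> [i|i j ij E|i j ij].
- by rewrite -(ring_per Hv (- (i + M))); congr v; lia.
- by apply: (@ring_inj _ _ _ _ _ Hv (- j) (- i)) => //; lia.
- rewrite Hc (Hc (v (- j))) => E; apply: (@ring_col _ _ _ _ _ Hv (- (j + 1)) (- (i + 1))).
    lia.
  rewrite (_ : - (j + 1) + 1 = - j); last lia.
  by rewrite (_ : - (i + 1) + 1 = - i); last lia.
Qed.

(** * Descent on the cycle length *)

Lemma rainbow_cycle_sub2d (m : nat) : Z.Odd d -> 12 * d <= Z.of_nat m ->
  rainbow_cycle c m -> rainbow_cycle c (Z.to_nat (Z.of_nat m - 2 * d + 2)).
Proof.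
move=> d_odd dM rm; have [d1|d3] : d = 1 \/ 3 <= d by have [k] := d_odd; lia.
  by rewrite (_ : Z.to_nat _ = m) //; lia.
apply: NNPP => noX; have [v Hv] := rainbow_cycle_ring rm.
have [L|F] := last_or_first_colored_all Hv dM d3 noX d_odd.
  apply: (not_all_last Hv dM d_odd) => k i k0 kM.
  exact: (last_colored_chord Hv dM d3 noX).
apply: (not_all_last (ring_opp Hv) dM d_odd) => k i k0 kM.
rewrite Hc /edge_color (Hc (v _) (v (- (i + _ + _)))).
have := first_colored_chord Hv dM d3 noX k0 (F (- (i + k * d + 1))) kM.
rewrite (_ : - (i + k * d + 1) + k * d + 1 = - i); last lia.
by move=> ->; rewrite /edge_color; congr (c (v _) (v _)); lia.
Qed.

Lemma no_rainbow_cycle_2modd q (m : nat) : (0 <= q)%Z ->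
  Z.of_nat m = d + 2 + q * d -> ~ rainbow_cycle c m.
Proof.
move=> q0; move: q q0 m; apply: natlike_ind => [|q q0 IH] m mE rm.
  by apply: noN; rewrite (_ : Z.to_nat _ = m) //; lia.
have qd : 0 <= q * d by nia.
have := rainbow_cycle_subd _ rm => /(_ ltac:(lia)).
by apply: IH; lia.
Qed.

(* [s] counts the [+ 2] moves modulo [d] that remain before the length is [2]
   modulo [d]. *)
Lemma no_rainbow_cycle_mod s : Z.Odd d -> 0 <= s -> forall q (m : nat),
  Z.of_nat m + 2 * s = 2 + q * d ->
  12 * d + s * (2 * d - 2) <= Z.of_nat m -> ~ rainbow_cycle c m.
Proof.
move=> d_odd; move: s; apply: natlike_ind => [|s s0 IH] q m mE mb rm.
  apply: (@no_rainbow_cycle_2modd (q - 1) m) => //; nia.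
have sd : 0 <= s * (2 * d - 2) by nia.
have := rainbow_cycle_sub2d d_odd _ rm => /(_ ltac:(lia)).
by apply: (IH (q - 2)); lia.
Qed.

Lemma no_large_rainbow_cycle (m : nat) : Z.Odd d ->
  2 * (d + 2) * (d + 2) <= Z.of_nat m -> ~ rainbow_cycle c m.
Proof.
move=> d_odd mb; have [h dh] := d_odd.
(* Again [h + 1] inverts 2 modulo [d], so the remainder [s] satisfies [2 * s = 2 - m] modulo [d]. *)
have D := Z.div_mod ((2 - Z.of_nat m) * (h + 1)) d.
have B := Z.mod_pos_bound ((2 - Z.of_nat m) * (h + 1)) d.
move: D B; move: (_ / d) (_ mod d) => a s D B.
apply: (@no_rainbow_cycle_mod s d_odd _ (2 - Z.of_nat m - 2 * a)).
- lia.
- have md : Z.of_nat m * d = 2 * (Z.of_nat m * h) + Z.of_nat m by rewrite dh; ring.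
  lia.
(* As [s <= d - 1], the required length is at most [12 * d + (d - 1) * (2 * d - 2) = 2 * d ^ 2 + 8 *
   d + 2], which is below [2 * (d + 2) ^ 2]. *)
- have : s * (2 * d - 2) <= (d - 1) * (2 * d - 2) by apply: Z.mul_le_mono_nonneg_r; lia.
  lia.
Qed.

End Chords.

Local Close Scope Z_scope.

Theorem theorem5 (V C : Type) (c : V -> V -> C) (Hc : coloring_sym c)
  (n : nat) (Hn : 3 <= n) (Hodd : odd n) :
  ~ rainbow_cycle c n ->
  forall m : nat, 2 * n ^ 2 <= m -> ~ rainbow_cycle c m.
Proof.
move=> noN m mn; apply: (@no_large_rainbow_cycle _ _ _ Hc (Z.of_nat n - 2)).
- lia.
- by rewrite (_ : Z.to_nat _ = n) //; lia.
- by exists (Z.of_nat n./2 - 1)%Z; lia.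
- by move: mn; rewrite -mulnn; lia.
Qed.
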